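(* Let $n \geqslant 3$ and $k$ be integers of the same parity with $\lfloor n/2 \rfloor \leqslant k \leqslant n-3$. Then $rn_k(C_n) = \mathrm{LB}(n,k)$, where, with $\varPhi(n,k) = \left\lceil \frac{3k+3-n}{2} \right\rceil$, $$\mathrm{LB}(n,k) = \begin{cases} \varPhi(n,k)\left(\frac{n-2}{2}\right) + k - \frac{n}{2} + 1 & \text{if } n \text{ is even},\\ \varPhi(n,k)\left(\frac{n-1}{2}\right) & \text{if } n \text{ is odd}.\end{cases}$$
   Context: $C_n$ is the cycle on vertex set $\mathbb{Z}_n$, with $u,v$ adjacent iff $u \equiv v \pm 1 \pmod n$; $d(u,v)$ is the graph distance. A radio-$k$-labeling of a graph $G$ is a function $f \colon V(G) \to \{0,1,2,\ldots\}$ with $|f(u)-f(v)| \geqslant k - d(u,v) + 1$ for all distinct $u,v$. The span of $f$ is $\max\{|f(u)-f(v)|\}$, and $rn_k(G)$ is the minimum span over all radio-$k$-labelings of $G$. *)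

(* Defs.v *)
From mathcomp Require Import all_boot all_order all_algebra.
From mathcomp Require Import boolp.

Set Implicit Arguments.
Unset Strict Implicit.
Unset Printing Implicit Defensive.

Import Order.TTheory GRing.Theory Num.Theory.

Section RadioLabeling.
Variables (T : finType) (e : rel T).

(* Least length of an e-path from u to v.  A shortest path has length < #|T|,
   so the search range is sufficient; #|T| is the value for unreachable v. *)
Definition gdist (u v : T) : nat :=
  find (fun m => [exists p : m.-tuple T, path e u p && (last u p == v)])
       (iota 0 #|T|).

Definition radio_labeling (k : nat) (f : T -> nat) : Prop :=
  forall u v : T, u != v ->
    (k%:Z - (gdist u v)%:Z + 1 <= `|(f u)%:Z - (f v)%:Z|)%R.

(* Here `|m - n| is the distance of the naturals m and n. *)
Definition label_span (f : T -> nat) : nat :=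
  \max_(u : T) \max_(v : T) `|f u - f v|.

Definition radio_span (k : nat) : pred nat :=
  fun s => `[< exists2 f : T -> nat, radio_labeling k f & label_span f = s >].

Lemma radio_span_ex (k : nat) : exists s, radio_span k s.
Proof.
pose f (u : T) := (enum_rank u * k.+1)%N.
exists (label_span f); apply/asboolP; exists f => // u v neq_uv.
have neq_r : enum_rank u != enum_rank v :> nat.
  by apply: contraNneq neq_uv => /val_inj/enum_rank_inj ->.
apply: (@Order.POrderTheory.le_trans _ _ (k.+1)%:Z%R).
  by rewrite -addn1 PoszD lerD2r lerBlDr lerDl.
rewrite /f !PoszM -mulrBl normrM ler_peMl //.
by rewrite -gtz0_ge1 normr_gt0 subr_eq0.
Qed.

Definition rn (k : nat) : nat := ex_minn (radio_span_ex k).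

End RadioLabeling.

Definition cycle_adj (n : nat) : rel 'I_n :=
  fun u v => (u == v + 1 %[mod n]) || (u + 1 == v %[mod n]).

Local Open Scope ring_scope.

Definition Phi (n k : nat) : int :=
  Num.ceil ((3 * k%:R + 3 - n%:R) / 2 : rat).

Definition LB (n k : nat) : rat :=
  if odd n then (Phi n k)%:~R * ((n%:R - 1) / 2)
  else (Phi n k)%:~R * ((n%:R - 2) / 2) + k%:R - n%:R / 2 + 1.

(* Main.v *)
(* Order the vertices by label.  The three distances within a triple of vertices
   of C_n sum to at most n, so labels two places apart in this order differ by at
   least (3k + 3 - n) / 2, hence by at least Phi; summing gives the lower bound.

   For the upper bound, walk through Z_n with labels growing alternately by A and
   Phi - A.  Since labels four places apart differ by more than k, only gaps of
   one, two and three places constrain the steps of the walk, and this leaves each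
   step the choice between two consecutive residues.  One choice keeps the walk
   inside a coset of a subgroup of Z_n (of Z_(n/2), on antipodal pairs, when n is
   even), the other moves it to the next coset, so all vertices can be visited.
   The delicate case is n odd and a = (n - k - 2) / 2 odd: a coset has an odd
   number of elements, but changing coset is possible only at a step of the right
   parity.  There the even-indexed and the odd-indexed vertices climb through the
   cosets separately, each spending two turns on every coset, half the range of
   cosets apart. *)
Require Import Defs.
From mathcomp Require Import all_boot all_order all_algebra.
From mathcomp Require Import boolp zify ring lra.

Set Implicit Arguments.
Unset Strict Implicit.
Unset Printing Implicit Defensive.

Import Order.TTheory GRing.Theory Num.Theory.

(** * Distances in the cycle *)

Lemma cycle_adjE n (u v : 'I_n) : 1 < n ->
  cycle_adj u v = [|| u == v.+1 :> nat, v == u.+1 :> nat,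
                     (u == 0 :> nat) && (v.+1 == n) |
                     (v == 0 :> nat) && (u.+1 == n)].
Proof.
move=> n_gt1; rewrite /cycle_adj !addn1 !(modn_small (ltn_ord _)).
have modS (w : 'I_n) : w.+1 %% n = if w.+1 == n then 0 else w.+1.
  case: eqP => [->|ne]; first by rewrite modnn.
  by rewrite modn_small //; move: (ltn_ord w) ne; lia.
rewrite !modS; have [ltu ltv] := (ltn_ord u, ltn_ord v).
by do 2![case: (_.+1 =P n) => ?]; apply/idP/idP; lia.
Qed.

Lemma cycle_adj_sym n (u v : 'I_n) : cycle_adj u v = cycle_adj v u.
Proof. by rewrite /cycle_adj orbC; congr (_ || _); rewrite eq_sym. Qed.

Lemma cycle_adj_ordS n (u : 'I_n) : cycle_adj u (ordS u).
Proof. by rewrite /cycle_adj /= !addn1 modn_mod eqxx orbT. Qed.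

Section GraphDistance.
Variables (T : finType) (e : rel T).

Lemma gdist_path_le (u v : T) (p : seq T) :
  path e u p -> last u p = v -> size p < #|T| -> gdist e u v <= size p.
Proof.
move=> ep lp lt_pT; rewrite leqNgt; apply/negP => /(before_find 0).
rewrite nth_iota // add0n => /existsP[].
by exists (in_tuple p); rewrite /= ep lp eqxx.
Qed.

Lemma gdist_pathP (u v : T) :
  (exists p, [/\ path e u p, last u p = v & size p = gdist e u v])
  \/ gdist e u v = #|T|.
Proof.
rewrite /gdist; set P := (P in find P _); case: (boolP (has P (iota 0 #|T|))).
  move=> hasP; left; have := nth_find 0 hasP.
  rewrite nth_iota; last by rewrite -[X in _ < X](size_iota 0) -has_find.
  rewrite add0n => /existsP[p /andP[ep /eqP lp]].
  by exists p; rewrite size_tuple.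
by move=> /hasNfind ->; right; rewrite size_iota.
Qed.

End GraphDistance.

(** Lifts a path to the integers: each edge moves the lift by one, and [q] counts the crossings of
    the edge between [n - 1] and [0]. *)
Lemma cycle_path_lift n (u : 'I_n) (p : seq 'I_n) : 1 < n ->
  path (@cycle_adj n) u p ->
  exists2 z : int, (`|z| <= (size p)%:Z)%R
    & exists q : int, (last u p)%:Z%R = (u%:Z + z + q * n%:Z)%R.
Proof.
move=> n_gt1; elim: p u => [|v p IHp] u /=; first by exists 0%R => //; exists 0%R; lia.
rewrite cycle_adjE // => /andP[uv /IHp[z zle [q ->]]].
case/or4P: uv => [/eqP uv|/eqP uv|/andP[/eqP u0 /eqP v0]|/andP[/eqP u0 /eqP v0]].
- by exists (z - 1)%R; [lia|exists q; lia].
- by exists (z + 1)%R; [lia|exists q; lia].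
- by exists (z - 1)%R; [lia|exists (q + 1)%R; rewrite mulrDl; lia].
- by exists (z + 1)%R; [lia|exists (q - 1)%R; rewrite mulrBl; lia].
Qed.

(* [z] is at circular distance at least [c] from [0] in the integers mod [n];
   vacuous when [c <= 0]. *)
Definition far (n : nat) (c z : int) : Prop :=
  exists q : int, (c <= z - q * n%:Z <= n%:Z - c)%R.

Lemma cycle_gdist_ge n (u v : 'I_n) (c : int) : 1 < n ->
  far n c (v%:Z - u%:Z)%R -> (c <= (gdist (@cycle_adj n) u v)%:Z)%R.
Proof.
move=> n_gt1 [q /andP[hq1 hq2]].
case: (gdist_pathP (@cycle_adj n) u v) => [[p [ep lp <-]]|->]; last first.
  by rewrite card_ord; lia.
have [z zle [q' eqz]] := cycle_path_lift n_gt1 ep.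
rewrite lp in eqz.
have {eqz} eqz : (v%:Z - u%:Z - q * n%:Z = z + (q' - q) * n%:Z)%R.
  by rewrite eqz; ring.
rewrite {}eqz in hq1 hq2; move: (size p) zle => s zle {ep lp p}.
(* If [q' - q <= 0] then [z >= c]; otherwise [z <= - c]. *)
have [le_q|lt_q] := lerP (q' - q)%R 0%R.
  have : ((q' - q) * n%:Z <= 0)%R by rewrite mulr_le0_ge0.
  by lia.
have : (1 * n%:Z <= (q' - q) * n%:Z)%R by apply: ler_wpM2r => //; lia.
by lia.
Qed.

Lemma iter_ordS n m (u : 'I_n) : iter m (@ordS n) u = (u + m) %% n :> nat.
Proof.
elim: m => [|m IHm]; first by rewrite addn0 modn_small.
by rewrite iterS /= IHm -addn1 modnDml addn1 addnS.
Qed.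

Lemma cycle_gdist_le_iter n m (u v : 'I_n) : m < n ->
  iter m (@ordS n) u = v ->
  gdist (@cycle_adj n) u v <= m /\ gdist (@cycle_adj n) v u <= m.
Proof.
move=> lt_mn uv; split.
  rewrite -(size_traject (@ordS n) (ordS u) m); apply: gdist_path_le.
  - apply: sub_path (fpath_traject _ _ _) => x y /eqP <-.
    exact: cycle_adj_ordS.
  - by rewrite last_traject.
  - by rewrite size_traject card_ord.
rewrite -(size_traject (@ord_pred n) (ord_pred v) m); apply: gdist_path_le.
- apply: sub_path (fpath_traject _ _ _) => x y /eqP <-.
  by rewrite cycle_adj_sym -{2}[x]ord_predK cycle_adj_ordS.
- rewrite last_traject -uv; elim: m {lt_mn uv} => // m IHm.
  by rewrite iterSr iterS ordSK.
- by rewrite size_traject card_ord.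
Qed.

Lemma cycle_gdist_le n (u v : 'I_n) : u != v ->
  gdist (@cycle_adj n) u v <= minn `|u - v| (n - `|u - v|).
Proof.
have mod2 (x : nat) : n <= x < n + n -> x %% n = x - n.
  by move=> ?; rewrite -(subnK (n := x) (m := n)) ?modnDr ?modn_small //; lia.
rewrite -val_eqE /= => neq_uv; have [ltu ltv] := (ltn_ord u, ltn_ord v).
have iterP (w w' : 'I_n) : w < w' ->
    iter (w' - w) (@ordS n) w = w' /\ iter (n - (w' - w)) (@ordS n) w' = w.
  move=> ww'; have [ltw ltw'] := (ltn_ord w, ltn_ord w'); split; apply: val_inj;
    rewrite /= iter_ordS.
    by rewrite subnKC ?modn_small // ltnW.
  by rewrite mod2; lia.
rewrite leq_min; have [lt_uv|lt_vu|//] := ltngtP u v.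
- have [e1 e2] := iterP _ _ lt_uv.
  have [|g1 _] := cycle_gdist_le_iter _ e1; first by lia.
  have [|_ g2] := cycle_gdist_le_iter _ e2; first by lia.
  by apply/andP; lia.
- have [e1 e2] := iterP _ _ lt_vu.
  have [|_ g1] := cycle_gdist_le_iter _ e1; first by lia.
  have [|g2 _] := cycle_gdist_le_iter _ e2; first by lia.
  by apply/andP; lia.
- by move=> /eqP; rewrite (negPf neq_uv).
Qed.

(** * Lower bound on the span *)

Lemma label_span_ge (T : finType) (f : T -> nat) (u v : T) :
  `|f u - f v| <= label_span f.
Proof. exact: leq_trans (leq_bigmax v) (leq_bigmax u). Qed.

Lemma label_order (T : finType) (f : T -> nat) : 0 < #|T| ->
  exists s : nat -> T, {in gtn #|T| &, injective s}
    /\ forall i j, i <= j < #|T| -> f (s i) <= f (s j).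
Proof.
case/card_gt0P => x0 _; pose s := sort (relpre f leq) (enum T).
have size_s : size s = #|T| by rewrite size_sort -cardE.
exists (nth x0 s); split=> [i j|i j /andP[le_ij ltj]].
  rewrite !inE -!size_s => lti ltj eq_s.
  by apply/eqP; rewrite -(nth_uniq x0 lti ltj) ?eq_s ?eqxx // sort_uniq enum_uniq.
have le_tr : transitive (relpre f leq) by move=> x y z; apply: leq_trans.
apply: (sorted_leq_nth le_tr) => //; rewrite ?inE ?size_s //.
- by move=> x /=.
- by apply: sort_sorted => x y; apply: leq_total.
- exact: leq_ltn_trans ltj.
Qed.

Section LowerBound.
Variables (n k p : nat) (f : 'I_n -> nat) (s : nat -> 'I_n).
Hypothesis f_radio : radio_labeling (@cycle_adj n) k f.
Hypothesis s_inj : {in gtn n &, injective s}.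
Hypothesis s_mono : forall i j, i <= j < n -> f (s i) <= f (s j).

Let neq_s i j : i < j < n -> s i != s j.
Proof. by case/andP=> ij jn; apply/eqP => /s_inj; rewrite !inE; lia. Qed.

Lemma order_gap i j : i < j < n ->
  (k%:Z + 1 - (minn `|s i - s j| (n - `|s i - s j|))%:Z
     <= (f (s j))%:Z - (f (s i))%:Z)%R.
Proof.
move=> ijn; have nij := neq_s ijn; have := cycle_gdist_le nij.
have := f_radio nij; have := @s_mono i j; move: (gdist _ _ _) => d; lia.
Qed.

Lemma order_gap1 i : i.+1 < n -> f (s i) + k + 1 <= f (s i.+1) + n./2.
Proof.
by move=> lt_in; have := @order_gap i i.+1; move: (ltn_ord (s i)) (ltn_ord (s i.+1)); lia.
Qed.

Hypothesis pE : 2 * p + n = 3 * k + 4.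

(* The three distances within a triple sum to at most [n]; parity then improves
   the resulting bound [(3k + 3 - n) / 2] to [p]. *)
Lemma order_gap2 i : i.+2 < n -> f (s i) + p <= f (s i.+2).
Proof.
move=> lt_in.
have := @order_gap i i.+1; have := @order_gap i.+1 i.+2; have := @order_gap i i.+2.
by move: (ltn_ord (s i)) (ltn_ord (s i.+1)) (ltn_ord (s i.+2)); lia.
Qed.

Lemma order_gap_double j : j.*2 < n -> f (s 0) + j * p <= f (s j.*2).
Proof.
elim: j => [|j IHj]; first by rewrite addn0.
rewrite doubleS mulSn => lt_jn; have := order_gap2 lt_jn.
have := IHj (ltnW (ltnW lt_jn)); lia.
Qed.

End LowerBound.

(* [LB n k], with [p] in the role of [Phi n k]. *)
Definition LBnat (n k p : nat) : nat :=
  (n.-1)./2 * p + (if odd n then 0 else k.+1 - n./2).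

Lemma radio_span_ge (n k p : nat) (f : 'I_n -> nat) : 0 < n ->
  2 * p + n = 3 * k + 4 -> radio_labeling (@cycle_adj n) k f ->
  LBnat n k p <= label_span f.
Proof.
move=> n_gt0 pE fr.
have [|s] := @label_order _ f; rewrite card_ord // => -[s_inj s_mono].
have gap j : j.*2 < n -> f (s 0) + j * p <= f (s j.*2).
  exact: (order_gap_double fr s_inj s_mono pE).
apply: leq_trans (label_span_ge f (s n.-1) (s 0)); rewrite /LBnat.
have := gap (n.-1)./2; case: ifP => odd_n.
  have -> : (n.-1)./2.*2 = n.-1 by lia.
  by move: (_ * p) => q; lia.
have gap1 i : i.+1 < n -> f (s i) + k + 1 <= f (s i.+1) + n./2.
  exact: (order_gap1 fr s_inj s_mono).
have := gap1 (n.-1)./2.*2.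
(* Needed when [k.+1 < n./2]: the truncated last term of [LBnat] is then 0. *)
have := s_mono (n.-1)./2.*2 n.-1.
have -> : (n.-1)./2.*2.+1 = n.-1 by lia.
by move: (_ * p) => q; lia.
Qed.

(** * From integer walks to radio labelings *)

Lemma far_opp n (c z : int) : far n c z -> far n c (- z)%R.
Proof. by case=> q ?; exists (- q - 1)%R; rewrite mulrBl mulNr; lia. Qed.

Lemma far_shift n (c z q : int) : far n c (z + q * n%:Z)%R -> far n c z.
Proof. by case=> q' ?; exists (q' - q)%R; rewrite mulrBl; lia. Qed.

Lemma far_le0 n (c z : int) : 0 < n -> (c <= 0)%R -> far n c z.
Proof.
move=> n_gt0 c_le0; exists (z %/ n%:Z)%Z; have := divz_eq z n.
have := @modz_ge0 z n; have := @ltz_pmod z n.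
by move: (_ * _)%R (_ %% _)%Z => y w; lia.
Qed.

(** The walk visits [x i] modulo [n] at time [i] and gives it label [F i]. Having [n] distinct
    residues, it is a bijection, so [F] composed with its inverse is a labeling. *)
Lemma radio_labeling_of_order (n k : nat) (x : nat -> int) (F : nat -> nat) :
  1 < n ->
  (forall i j, i < j < n -> ~~ (n %| (x j - x i)%R)%Z) ->
  {homo F : i j / i <= j} ->
  (forall i j, i < j < n ->
     far n (k%:Z + 1 - ((F j)%:Z - (F i)%:Z))%R (x j - x i)%R) ->
  exists2 f, radio_labeling (@cycle_adj n) k f & label_span f <= F n.-1.
Proof.
move=> n_gt1 x_inj F_mono x_far.
have posP i : `|(x i %% n)%Z| < n.
  by have := @modz_ge0 (x i) n; have := @ltz_pmod (x i) n; lia.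
have [pos posE] : exists pos : 'I_n -> 'I_n,
    forall i, (pos i)%:Z%R = (x i %% n)%Z.
  exists (fun i => Ordinal (posP i)) => i.
  by rewrite /= abszE ger0_norm // modz_ge0 //; lia.
have pos_inj : injective pos.
  suff inj (i j : 'I_n) : i < j -> pos i <> pos j.
    move=> i j eq_ij; apply: val_inj => /=.
    by case: (ltngtP i j) => // /inj; rewrite eq_ij.
  move=> lt_ij /(congr1 (fun u : 'I_n => u%:Z%R)); rewrite !posE => /eqP.
  by rewrite eq_sym eqz_mod_dvd (negPf (x_inj _ _ _)) // lt_ij /=.
have pos_far (i j : 'I_n) : i < j ->
    far n (k%:Z + 1 - ((F j)%:Z - (F i)%:Z))%R ((pos j)%:Z - (pos i)%:Z)%R.
  move=> lt_ij; apply: (@far_shift _ _ _ ((x j %/ n)%Z - (x i %/ n)%Z)%R).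
  have := x_far i j; rewrite lt_ij ltn_ord => /(_ isT).
  rewrite {1}(divz_eq (x j) n) {1}(divz_eq (x i) n) !posE.
  by congr (far _ _ _); ring.
exists (F \o invF pos_inj) => [u v|].
  rewrite -{1 2}(f_invF pos_inj u) -{1 2}(f_invF pos_inj v) /=.
  move: (invF _ u) (invF _ v) => i j; rewrite (inj_eq pos_inj) -val_eqE /= => ne_ij.
  have [lt_ij|lt_ji|/eqP] := ltngtP i j; last by rewrite (negPf ne_ij).
    have := cycle_gdist_ge n_gt1 (pos_far _ _ lt_ij).
    by have := F_mono i j; lia.
  have /far_opp := pos_far _ _ lt_ji; rewrite (opprB (pos i)%:Z)%R => far_ij.
  have := cycle_gdist_ge n_gt1 far_ij.
  by have := F_mono j i; lia.
apply/bigmax_leqP => u _; apply/bigmax_leqP => v _ /=.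
have F_le (i : 'I_n) : F i <= F n.-1.
  by apply: F_mono; move: (ltn_ord i); lia.
by have := F_le (invF pos_inj u); have := F_le (invF pos_inj v); lia.
Qed.

Lemma far_of_short_gaps (n k : nat) (x : nat -> int) (F : nat -> nat) :
  0 < n -> {homo F : i j / i <= j} ->
  (forall i, F i + k < F i.+4) ->
  (forall i, far n (k%:Z + 1 - ((F i.+1)%:Z - (F i)%:Z))%R (x i.+1 - x i)%R) ->
  (forall i, far n (k%:Z + 1 - ((F i.+2)%:Z - (F i)%:Z))%R (x i.+2 - x i)%R) ->
  (forall i, far n (k%:Z + 1 - ((F i.+3)%:Z - (F i)%:Z))%R (x i.+3 - x i)%R) ->
  forall i j, i < j ->
     far n (k%:Z + 1 - ((F j)%:Z - (F i)%:Z))%R (x j - x i)%R.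
Proof.
move=> n_gt0 F_mono F4 far1 far2 far3 i j /subnKC <-.
rewrite addSn; case: (j - i.+1) => [|[|[|d]]]; rewrite ?addn0 ?addn1 ?addn2 //.
by apply: far_le0 => //; have := F4 i; have := F_mono i.+4 (i + d.+3).+1; lia.
Qed.

(** Any two consecutive increments add up to [p], so the lower bound for labels two places apart is
    attained throughout. *)
Definition alt_label (p a i : nat) : nat := i./2 * p + odd i * a.

Lemma alt_labelS p a i : a <= p ->
  alt_label p a i.+1 = alt_label p a i + (if odd i then p - a else a).
Proof.
rewrite /alt_label /= uphalf_half => ?; case: (odd i) => /=; rewrite ?mulnDl; lia.
Qed.

Lemma alt_label_homo p a : a <= p -> {homo alt_label p a : i j / i <= j}.
Proof.
by move=> ap; apply: homo_leq leqnn leq_trans _ => i; rewrite alt_labelS // leq_addr.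
Qed.

(* Here [n = 2m + 1], [k + 1 = 2(m - a)] and [Phi = 2m - 3a]; the even-to-odd
   label increment is [m - 2a + t].  Each [d i] selects one of the two steps. *)
Lemma odd_cycle_walk (m a t : nat) (x : nat -> int) (d : nat -> nat) :
  0 < a -> 2 * a + 1 <= m -> t <= a ->
  (forall i, d i + d i.+1 <= 1) ->
  (forall i, x i.+1 = x i + (if odd i then m - a + t + d i else m - t + d i)%N%:Z)%R ->
  (forall i j, i < j < m.*2.+1 -> ~~ (m.*2.+1 %| (x j - x i)%R)%Z) ->
  exists2 f, radio_labeling (@cycle_adj m.*2.+1) (2 * (m - a)).-1 f
    & label_span f <= m * (2 * m - 3 * a).
Proof.
move=> a_gt0 am ta d1 xS x_inj.
pose F := alt_label (2 * m - 3 * a) (m - 2 * a + t).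
have FS i : F i.+1 = F i + (if odd i then m - a - t else m - 2 * a + t).
  by rewrite /F alt_labelS; [case: odd; lia|lia].
have F_mono : {homo F : i j / i <= j} by apply: alt_label_homo; lia.
have -> : m * (2 * m - 3 * a) = F m.*2.+1.-1.
  by rewrite /F /alt_label /= doubleK odd_double; lia.
apply: (radio_labeling_of_order _ x_inj F_mono); first lia.
move=> i j /andP[ltij _]; move: i j ltij.
(* The witnesses count full turns. Two steps total [2m - a + d i + d i.+1] and must stay [a] away
   from [n], which is why [d i + d i.+1 <= 1] is assumed. *)
apply: far_of_short_gaps => // [i|i|i|i]; rewrite !FS ?xS /=;
  have ? := d1 i; have ? := d1 i.+1; [| exists 0%R|exists 0%R|exists 1%R];
  case: (odd i) => /=; lia.
Qed.

(* Here [n = 2m], [k + 1 = 2(m - a) - 1] and [Phi = 2m - 3a - 1]; every other step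
   joins antipodal vertices. *)
Lemma even_cycle_walk (m a : nat) (x : nat -> int) (d : nat -> nat) :
  0 < a -> 2 * a + 2 <= m ->
  (forall i, d i <= 1) ->
  (forall i, x i.+1 = x i + (if odd i then m + a + d i else m)%N%:Z)%R ->
  (forall i j, i < j < m.*2 -> ~~ (m.*2 %| (x j - x i)%R)%Z) ->
  exists2 f, radio_labeling (@cycle_adj m.*2) (2 * (m - a)).-2 f
    & label_span f <= m.-1 * (2 * m - 3 * a - 1) + (m - 2 * a - 1).
Proof.
move=> a_gt0 am d1 xS x_inj.
pose F := alt_label (2 * m - 3 * a - 1) (m - 2 * a - 1).
have FS i : F i.+1 = F i + (if odd i then m - a else m - 2 * a - 1).
  by rewrite /F alt_labelS; [case: odd; lia|lia].
have F_mono : {homo F : i j / i <= j} by apply: alt_label_homo; lia.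
have -> : m.-1 * (2 * m - 3 * a - 1) + (m - 2 * a - 1) = F m.*2.-1.
  rewrite /F /alt_label.
  have -> : m.*2.-1./2 = m.-1 by lia.
  have -> : odd m.*2.-1 = true by lia.
  by lia.
apply: (radio_labeling_of_order _ x_inj F_mono); first lia.
move=> i j /andP[ltij _]; move: i j ltij.
apply: far_of_short_gaps => // [|i|i|i|i]; rewrite ?FS ?xS /=; first lia;
  have ? := d1 i; have ? := d1 i.+1; have ? := d1 i.+2;
  [|exists 0%R|exists 1%R|exists 1%R];
  case: (odd i) => /=; lia.
Qed.

(* Determines when [i * d - r] and [j * d - s] coincide mod [n]: the multiples of
   [d] stay in one coset of the subgroup [<d>], which [r] and [s] shift. *)
Lemma coset_walk (n d i j r s : nat) :
  0 < n -> i <= j -> r < gcdn n d -> s < gcdn n d ->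
  (n %| (((j - i) * d)%N%:Z + (s%:Z - r%:Z))%R)%Z ->
  r = s /\ n %/ gcdn n d %| j - i.
Proof.
set g := gcdn n d => n_gt0 le_ij lt_rg lt_sg n_dvd.
have g_gt0 : 0 < g by rewrite gcdn_gt0 n_gt0.
have g_dvd : (g %| (s%:Z - r%:Z)%R)%Z.
  have gn : (g %| Posz n)%Z by exact: dvdn_gcdl.
  have gd : (g %| Posz ((j - i) * d))%Z by apply: dvdn_mull; exact: dvdn_gcdr.
  by have := dvdz_trans gn n_dvd; rewrite rpredDl.
have rs : r = s.
  move: g_dvd; rewrite /dvdz /=; case: (ltngtP r s) => // rs /dvdn_leq; lia.
split=> //; move: n_dvd; rewrite rs subrr addr0 => {}n_dvd.
have {n_dvd} : n %| (j - i) * d by exact: n_dvd.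
have gn : g %| n by exact: dvdn_gcdl.
have gd : g %| d by exact: dvdn_gcdr.
rewrite -(@Gauss_dvdl (n %/ g) (j - i) (d %/ g)).
  by rewrite -[(_ %/ _ %| _)](dvdn_pmul2r g_gt0) -mulnA !divnK.
by rewrite /coprime -(eqn_pmul2r g_gt0) mul1n muln_gcdl !divnK.
Qed.

Lemma divn_step (u e d : nat) : 0 < d -> e <= d ->
  u %/ d <= (u + e) %/ d <= (u %/ d).+1.
Proof.
move=> d_gt0 le_ed; rewrite leq_div2r ?leq_addr //=.
have -> : (u %/ d).+1 = (u + d) %/ d by rewrite divnDr ?dvdnn // divnn d_gt0 addn1.
by rewrite leq_div2r // leq_add2l.
Qed.

Lemma divn_inj_mod (d i j : nat) :
  0 < d -> i <= j -> i %/ d = j %/ d -> d %| j - i -> i = j.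
Proof.
move=> d_gt0 le_ij eq_div; rewrite -eqn_mod_dvd // => /eqP eq_mod.
by rewrite (divn_eq i d) (divn_eq j d) eq_div eq_mod.
Qed.

(** * Walks through all vertices *)

(** With [t = a./2] both kinds of step equal [D], up to [d]. The order of [D] modulo [n] is [L], so
    the walk fills a coset in [L] steps, and one extra unit then moves it to the next. *)
Lemma odd_cycle_labeling_even (m a : nat) : 0 < a -> 2 * a + 1 <= m -> ~~ odd a ->
  exists2 f, radio_labeling (@cycle_adj m.*2.+1) (2 * (m - a)).-1 f
    & label_span f <= m * (2 * m - 3 * a).
Proof.
move=> a_gt0 am even_a; pose n := m.*2.+1; pose D := m - a./2.
pose g := gcdn n D; pose L := n %/ g.
have g_gt0 : 0 < g by rewrite gcdn_gt0.
have nE : n = L * g by rewrite divnK // dvdn_gcdl.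
(* Ensures that two consecutive steps change coset at most once. *)
have L_gt1 : 1 < L.
  have : g <= D by rewrite dvdn_leq ?dvdn_gcdr // /D; lia.
  by rewrite /D; move: nE; rewrite /n; case: (L) => [|[|l]] //; lia.
have L_gt0 : 0 < L := ltnW L_gt1.
have step i e : e <= 2 -> i %/ L <= (i + e) %/ L <= (i %/ L).+1.
  by move=> ?; apply: divn_step => //; lia.
apply: (@odd_cycle_walk m a a./2 (fun i => Posz (i * D + i %/ L))
  (fun i => i.+1 %/ L - i %/ L)) => // [|i|i|i j /andP[lt_ij lt_jn]].
- by lia.
- by have := step i 2; have := step i 1; rewrite addn1 addn2; lia.
- have -> : m - a + a./2 = D by lia.
  have := step i 1; rewrite addn1 mulSn -/D; move: (i * D) => y.
  by case: ifP => _; lia.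
- apply/negP => n_dvd.
  have lt_g u : u < n -> u %/ L < g by rewrite ltn_divLR // mulnC -nE.
  have [|||eq_div L_dvd] := @coset_walk n D i j (i %/ L) (j %/ L) isT (ltnW lt_ij).
  + exact: lt_g (ltn_trans lt_ij lt_jn).
  + exact: lt_g lt_jn.
  + by move: n_dvd; congr (_ %| _)%Z; rewrite mulnBl; have := leq_mul2r D i j; lia.
  have eq_ij : i = j by apply: (@divn_inj_mod L) => //; exact: ltnW.
  by rewrite eq_ij ltnn in lt_ij.
Qed.

Lemma odd_cycle_labeling_odd (m a : nat) : 2 * a + 1 <= m -> odd a ->
  exists2 f, radio_labeling (@cycle_adj m.*2.+1) (2 * (m - a)).-1 f
    & label_span f <= m * (2 * m - 3 * a).
Proof.
move=> am odd_a; have a_gt0 : 0 < a by case: (a) odd_a.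
pose n := m.*2.+1.
have [D DE] : exists D, D = m - a./2 by exists (m - a./2).
have [g gE] : exists g, g = gcdn n D by exists (gcdn n D).
have g_gt0 : 0 < g by rewrite gE gcdn_gt0.
have g_dvdn : g %| n by rewrite gE dvdn_gcdl.
have odd_g : odd g by rewrite (dvdn_odd g_dvdn) //= odd_double.
have [L nE] : exists L, n = L * g by apply/dvdnP.
have odd_L : odd L by have := oddM L g; rewrite -nE /= odd_double odd_g andbT.
(* Since [2 * D + a = n], [g] divides [a]; this gives [(a + g)./2 <= a] for the offset used
   below. *)
have le_ga : g <= a.
  have g_dvd2D : g %| D * 2 by rewrite dvdn_mulr // gE dvdn_gcdr.
  apply: dvdn_leq => //.
  by rewrite -(dvdn_addr _ g_dvd2D) (_ : D * 2 + a = n) // DE /n; lia.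
have [e eE] : exists e, e = L.*2 by exists L.*2.
have L_gt0 : 0 < L by case: (L) odd_L.
have e_gt0 : 0 < e by rewrite eE double_gt0.
(* Bounds both quotients in [r] by [g./2], so that all cosets stay below [g]. *)
have eg : (g./2).+1 * e = n + L.
  rewrite nE eE -doubleMr doubleMl (_ : (g./2).+1.*2 = g.+1) ?mulSn; last by lia.
  by rewrite addnC mulnC.
have step2 i : i %/ e <= i.+2 %/ e <= (i %/ e).+1.
  by rewrite -addn2; apply: divn_step => //; lia.
have stepL i : i %/ e <= (i.+1 + L) %/ e <= (i %/ e).+1.
  by rewrite addSnnS; apply: divn_step => //; lia.
have stepL1 i : i.+1 %/ e <= (i + L) %/ e <= (i.+1 %/ e).+1.
  by rewrite -(prednK L_gt0) -addSnnS; apply: divn_step => //; lia.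
(* The coset of the i-th vertex: each parity class changes coset every [2L] steps,
   the odd class [g./2] cosets ahead and [L] steps earlier.  In the middle coset,
   shared by both classes, they meet each other's gaps because [L] is odd. *)
pose r i := if odd i then g./2 + (i + L) %/ e else i %/ e.
apply: (@odd_cycle_walk m a (a + g)./2 (fun i => (Posz (i * D) - Posz (r i))%R)
  (fun i => if odd i then (i + L) %/ e - i.+1 %/ e
            else (i %/ e).+1 - (i.+1 + L) %/ e)) => // [|i|i|i j /andP[lt_ij lt_jn]].
- by lia.
- move: (stepL i) (stepL1 i) (stepL i.+1) (stepL1 i.+1) (step2 i) (step2 (i + L)).
  rewrite /= !addSn; move: (_ %/ e) (i.+1 %/ e) (_.+2 %/ e) (_ %/ e) (_ %/ e) (_ %/ e).
  by case: (odd i) => /= *; lia.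
- move: (stepL i) (stepL1 i); rewrite mulSn /r /= addSn.
  move: (i * D) (i %/ e) (i.+1 %/ e) ((i + L) %/ e) ((i + L).+1 %/ e).
  by case: (odd i) => /= *; lia.
- apply/negP => n_dvd.
  have r_lt u : u < n -> r u < g.
    move=> lt_un; rewrite /r; case: ifP => odd_u.
      have : (u + L) %/ e < (g./2).+1 by rewrite ltn_divLR // eg ltn_add2r.
      by lia.
    have : u %/ e < (g./2).+1 by rewrite ltn_divLR // eg ltn_addr.
    by lia.
  have [|||] := @coset_walk n D i j (r j) (r i) isT (ltnW lt_ij).
  + by rewrite -gE; exact: r_lt.
  + by rewrite -gE; apply/r_lt/(ltn_trans lt_ij lt_jn).
  + move: n_dvd; congr (_ %| _)%Z; rewrite mulnBl.
    have := leq_mul2r D i j; rewrite (ltnW lt_ij) orbT.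
    by move: (i * D) (j * D) => y z; lia.
  rewrite -gE nE mulnK // => eq_r L_dvd.
  have [q jE] : exists q, j = i + q * L.
    by case/dvdnP: L_dvd => q qE; exists q; rewrite -qE subnKC // ltnW.
  have q_gt0 : 0 < q by case: (q) jE lt_ij => // ->; rewrite addn0 ltnn.
  have odd_j : odd j = odd i (+) odd q by rewrite jE oddD oddM odd_L andbT.
  have divD u h : (u + h * e) %/ e = u %/ e + h by rewrite addnC divnMDl // addnC.
  have qE : q * L = odd q * L + q./2 * e.
    by rewrite -{1}(odd_double_half q) mulnDl eE -doubleMl -doubleMr.
  have sumE c : j + c = i + (odd q * L + c) + q./2 * e by rewrite jE qE; lia.
  clear n_dvd L_dvd g_dvdn qE jE step2 stepL stepL1.
  move: eq_r; rewrite /r odd_j; case: (boolP (odd q)) => odd_q; case: (odd i) => /=.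
  (* The only delicate case, [i] odd and [j] even: equal cosets force [q./2 = g./2], hence
     [j = i + n], out of range. In the other cases [r j > r i]. *)
  + have := sumE 0; rewrite odd_q mul1n !addn0 => jE.
    rewrite {1}jE divD addnC => /addIn eq_r.
    by move: jE lt_jn eg; rewrite eq_r mulSn; move: (_ * e) => y; lia.
  + rewrite sumE odd_q mul1n (_ : i + (L + L) = i + 1 * e) ?divD.
      by move: (i %/ e) => y; lia.
    by rewrite eE mul1n addnn.
  + by rewrite sumE (negPf odd_q) mul0n add0n divD; move: (_ %/ e) => y; lia.
  + have := sumE 0; rewrite (negPf odd_q) !addn0 => ->; rewrite divD.
    by move: (i %/ e) => y; lia.
Qed.

(** Times [2h] and [2h + 1] visit an antipodal pair. Modulo [m] the pairs perform a walk with step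
    [a], changing coset every [L] pairs. *)
Lemma even_cycle_labeling (m a : nat) : 0 < a -> 2 * a + 2 <= m ->
  exists2 f, radio_labeling (@cycle_adj m.*2) (2 * (m - a)).-2 f
    & label_span f <= m.-1 * (2 * m - 3 * a - 1) + (m - 2 * a - 1).
Proof.
move=> a_gt0 am; have m_gt0 : 0 < m by lia.
have [g gE] : exists g, g = gcdn m a by exists (gcdn m a).
have g_gt0 : 0 < g by rewrite gE gcdn_gt0 m_gt0.
have [L mE] : exists L, m = L * g by apply/dvdnP; rewrite gE dvdn_gcdl.
have L_gt0 : 0 < L by case: (L) mE m_gt0 => // ->.
have step i : i %/ L <= i.+1 %/ L <= (i %/ L).+1.
  by rewrite -addn1; exact: divn_step.
apply: (@even_cycle_walk m a (fun i => Posz (i./2 * a + i./2 %/ L + i * m))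
  (fun i => i./2.+1 %/ L - i./2 %/ L)) => // [i|i|i j /andP[lt_ij lt_jn]].
- by have := step i./2; lia.
- have := step i./2; rewrite /= uphalf_half.
  case: (odd i) => /=; rewrite ?add1n ?add0n ?mulSn;
    move: (i./2 * a) (i./2 %/ L) (i./2.+1 %/ L) => y z w; lia.
- apply/negP => n_dvd.
  have lt_g u : u < m -> u %/ L < g by rewrite ltn_divLR // mulnC -mE.
  have le_ij2 : i./2 <= j./2 by rewrite half_leq // ltnW.
  have [|||eq_div] := @coset_walk m a i./2 j./2 (i./2 %/ L) (j./2 %/ L) m_gt0 le_ij2.
  + by rewrite -gE; apply: lt_g; lia.
  + by rewrite -gE; apply: lt_g; lia.
  (* Reducing modulo [m] identifies antipodal vertices and removes the terms [i * m] and [j * m]. *)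
  + have : (m %| Posz m.*2)%Z by rewrite -muln2; apply: dvdn_mulr.
    move=> /dvdz_trans/(_ n_dvd).
    have dvd_mul c : (m %| Posz (c * m))%Z by apply: dvdn_mull.
    rewrite !PoszD opprD addrACA rpredDr; last exact: rpredB.
    congr (_ %| _)%Z; rewrite mulnBl.
    have := leq_mul2r a i./2 j./2; rewrite le_ij2 orbT.
    by move: (i./2 * a) (j./2 * a) => y z; lia.
  rewrite -gE {1}mE mulnK // => L_dvd.
  have eq2 := divn_inj_mod L_gt0 le_ij2 eq_div L_dvd.
  (* Same pair, hence a difference of exactly [m], which [2m] does not divide. *)
  have jS : j = i.+1 by lia.
  have {n_dvd} : (m.*2 %| Posz m)%Z.
    move: n_dvd; rewrite -eq2 jS mulSn; congr (_ %| _)%Z.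
    by move: (i./2 * a + _) (i * m) => y z; lia.
  by move/dvdn_leq => /(_ m_gt0) /=; lia.
Qed.

Lemma rn_cycleE (n k p : nat) : 0 < n -> 2 * p + n = 3 * k + 4 ->
  (exists2 f, radio_labeling (@cycle_adj n) k f & label_span f <= LBnat n k p) ->
  rn (@cycle_adj n) k = LBnat n k p.
Proof.
move=> n_gt0 pE [f f_radio f_span]; rewrite /rn; case: ex_minnP => s.
move=> /asboolP[h h_radio <-] h_min; apply/eqP; rewrite eqn_leq radio_span_ge // andbT.
by apply: leq_trans (h_min (label_span f) _) f_span; apply/asboolP; exists f.
Qed.

(** The hypothesis makes [(3k + 3 - n) / 2] equal to [p - 1/2], whose ceiling is [p]. *)
Lemma PhiE (n k p : nat) : 2 * p + n = 3 * k + 4 -> Phi n k = p%:Z%R.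
Proof.
move=> pE; have {}pE : (2 * p%:R + n%:R = 3 * k%:R + 4 :> rat)%R.
  by rewrite -!natrM -!natrD pE.
by apply: ceil_def; rewrite rmorphB /= -pmulrn; apply/andP; split; lra.
Qed.

Lemma LBE (n k p : nat) : 0 < n -> n./2 <= k.+1 -> 2 * p + n = 3 * k + 4 ->
  LB n k = ((LBnat n k p)%:R)%R.
Proof.
move=> n_gt0 le_nk pE; rewrite /LB (PhiE pE) -pmulrn /LBnat.
have [odd_n|even_n] := ifP; rewrite natrD natrM.
  have -> : n = (n.-1)./2 * 2 + 1 :> nat by lia.
  by rewrite addn1 /= muln2 doubleK -muln2 -addn1 natrD natrM; field.
have -> : (n.-1)./2 = (n./2).-1 by lia.
rewrite natrB // -subn1 natrB; last by lia.
have {1 2}-> : n = n./2 * 2 :> nat by lia.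
by rewrite natrM -[k.+1]addn1 natrD; field.
Qed.

Theorem theorem3p4 (n k : nat) :
  3 <= n -> odd n = odd k -> n %/ 2 <= k -> k <= n - 3 ->
  ((rn (@cycle_adj n) k)%:R)%R = LB n k.
Proof.
rewrite divn2 => n_ge3 odd_nk le_nk le_kn.
pose p := (3 * k + 4 - n)./2; have pE : 2 * p + n = 3 * k + 4 by lia.
have n_gt0 : 0 < n by lia.
rewrite (LBE n_gt0 (leqW le_nk) pE) (rn_cycleE n_gt0 pE) //.
rewrite /LBnat; case: ifP => odd_n.
  (* For both parities of [n], [a] is [(n - k - 2) / 2]. Equal parity and [k <= n - 3] give
     [a >= 1]; [n./2 <= k] gives [2a + 1 <= m], or [2a + 2 <= m] for even [n]. *)
  pose m := n./2; pose a := m - (k.+1)./2.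
  have := @odd_cycle_labeling_even m a; have := @odd_cycle_labeling_odd m a.
  have -> : m.*2.+1 = n by lia.
  have -> : (2 * (m - a)).-1 = k by lia.
  have -> : (n.-1)./2 = m by lia.
  have -> : 2 * m - 3 * a = p by lia.
  by rewrite addn0; case: (odd a) => H1 H2; [apply: H1|apply: H2]; lia.
pose m := n./2; pose a := m.-1 - k./2.
have := @even_cycle_labeling m a.
have -> : m.*2 = n by lia.
have -> : (2 * (m - a)).-2 = k by lia.
have -> : (n.-1)./2 = m.-1 by lia.
have -> : 2 * m - 3 * a - 1 = p by lia.
have -> : k.+1 - n./2 = m - 2 * a - 1 by lia.
by apply; lia.
Qed.
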